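(* Let $m,l,\hbar>0$, $\mu\in\mathbb{N}$ ($\mu\ge1$) and $\beta>0$. Let $f^1_{\mu,\beta}(x,t)=|\Psi_{\mu,\beta}(x,t)|^2$, $\mathcal{T}_\mu=\frac{ml^2}{2\pi\hbar\mu^2}$, and $$\overline{f}^1_{\mu,\beta}(x)=\frac{1}{\mathcal{T}_\mu}\int_0^{\mathcal{T}_\mu}f^1_{\mu,\beta}(x,t)\,dt .$$ Then for $0\le x\le l$ $$\overline{f}^1_{\mu,\beta}(x)=\frac{2}{N(\beta)}\sum_{k=-\infty}^{+\infty}e^{-\frac{\pi\beta}{2}(2k+1)^2}\sin^2\!\left[(2k+1)\frac{\pi\mu}{l}x\right].$$
   Context: $\theta_1(z,\tau)=\sum_{k\in\mathbb{Z}}e^{\,i\frac{\pi\tau}{4}(2k+1)^2+i\frac{\pi}{2}(2z+1)(2k+1)}$ for $z\in\mathbb{C}$, $\operatorname{Im}\tau>0$. $N(\beta)=l\sum_{k\in\mathbb{Z}}e^{-\frac{\pi\beta}{2}(2k+1)^2}$. $\Psi_{\mu,\beta}(x,t)=\frac{1}{\sqrt{N(\beta)}}\theta_1\left(\mu\frac{x}{l},-\mu^2\frac{2\pi\hbar}{ml^2}t+i\beta\right)$. *)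

(* Defs.v *)
From Stdlib Require Import Reals ZArith.
From Coquelicot Require Import Coquelicot.
Open Scope R_scope.

(* [Series] is defined for sequences indexed by [nat]; a sum over Z is split into
   the terms of index 0, 1, 2, ... and those of index -1, -2, ... *)
Definition ZSeries (a : Z -> R) : R :=
  Series (fun n : nat => a (Z.of_nat n))
  + Series (fun n : nat => a (- Z.of_nat (S n))%Z).

Definition CZSeries (a : Z -> C) : C :=
  (ZSeries (fun k => Re (a k)), ZSeries (fun k => Im (a k))).

Definition Cexp (z : C) : C :=
  (exp (Re z) * cos (Im z), exp (Re z) * sin (Im z)).

Definition theta1 (z tau : C) : C :=
  CZSeries (fun k : Z =>
    Cexp (Ci * (PI * tau / 4) * RtoC (IZR (2 * k + 1)) ^ 2
          + Ci * (PI / 2) * (2 * z + 1) * RtoC (IZR (2 * k + 1))))%C.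

Definition Nbeta (l beta : R) : R :=
  l * ZSeries (fun k : Z => exp (- (PI * beta / 2) * IZR (2 * k + 1) ^ 2)).

Definition Psi (m l hbar : R) (mu : nat) (beta x t : R) : C :=
  (RtoC (1 / sqrt (Nbeta l beta))
   * theta1 (RtoC (INR mu * (x / l)))
       (RtoC (- (INR mu ^ 2 * (2 * PI * hbar / (m * l ^ 2)) * t)) + Ci * RtoC beta))%C.

Definition f1 (m l hbar : R) (mu : nat) (beta x t : R) : R :=
  Cmod (Psi m l hbar mu beta x t) ^ 2.

Definition Tmu (m l hbar : R) (mu : nat) : R :=
  m * l ^ 2 / (2 * PI * hbar * INR mu ^ 2).

Definition f1_mean (m l hbar : R) (mu : nat) (beta x : R) : R :=
  1 / Tmu m l hbar mu
  * RInt (fun t => f1 m l hbar mu beta x t) 0 (Tmu m l hbar mu).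

(* Main.v *)
(** Pairing the indices [k] and [-k-1], i.e. the odd numbers [n] and [-n], turns
    [theta1] into a series over [n = 1, 3, 5, ...] of real coefficients [a_n] times
    [exp (-i PI n^2 t / (4 T))], where [T] is the averaging time. Two frequencies
    differ by an integer multiple of [PI / T], so the real parts of the cross terms of the
    squared modulus integrate to [0] over [[0, T]]; by uniform convergence
    the mean is the sum of the [a_n^2]. *)

Require Import Defs.
From Stdlib Require Import Reals ZArith Lra Lia.
From Coquelicot Require Import Coquelicot.
Open Scope R_scope.

(** * Tail estimates for dominated series *)

Lemma ex_series_dominated (a b : nat -> R) :
  (forall k, Rabs (b k) <= a k) -> ex_series a -> ex_series b.
Proof. intros H Ha. now apply (ex_series_le b a). Qed.

Lemma Series_tail_dominated (a b : nat -> R) (N : nat) :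
  (forall k, Rabs (b k) <= a k) -> ex_series a ->
  Rabs (Series b - sum_f_R0 b N) <= Series a - sum_f_R0 a N.
Proof.
  intros H Ha.
  assert (Hb : ex_series b) by now apply (ex_series_dominated a).
  (* [sum_f_R0 _ N] includes the index [N], so the remainder starts at [S N]. *)
  rewrite (Series_incr_n b (S N)), (Series_incr_n a (S N)) by (easy || lia).
  simpl pred.
  replace (sum_f_R0 b N + _ - _) with (Series (fun k => b (S N + k)%nat)) by ring.
  replace (sum_f_R0 a N + _ - _) with (Series (fun k => a (S N + k)%nat)) by ring.
  assert (Ha' : ex_series (fun k => a (S N + k)%nat))
    by now apply (ex_series_incr_n a (S N)).
  eapply Rle_trans; [apply Series_Rabs | apply Series_le]; auto.
  - apply (ex_series_dominated (fun k => a (S N + k)%nat)); auto.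
    intros k; now rewrite Rabs_Rabsolu.
  - intros k; split; [apply Rabs_pos | auto].
Qed.

Lemma Series_dominated (a b : nat -> R) :
  (forall k, Rabs (b k) <= a k) -> ex_series a -> Rabs (Series b) <= Series a.
Proof.
  intros H Ha.
  eapply Rle_trans; [apply Series_Rabs | apply Series_le]; auto.
  - apply (ex_series_dominated a); auto. intros k; now rewrite Rabs_Rabsolu.
  - intros k; split; [apply Rabs_pos | auto].
Qed.

(** With [B] the sum and [b'] the partial sum, the square difference factors as
    [(2 * B - (B - b')) * (B - b')], whose first factor is at most [2 * A + A] for [A = Series a].
    The bound depends on [a] alone, hence is uniform when [b] varies with time. *)
Lemma sq_Series_tail_dominated (a b : nat -> R) (N : nat) :
  (forall k, Rabs (b k) <= a k) -> ex_series a ->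
  Rabs (Series b ^ 2 - sum_f_R0 b N ^ 2)
    <= 3 * Series a * (Series a - sum_f_R0 a N).
Proof.
  intros H Ha.
  pose proof (Series_tail_dominated a b N H Ha) as Ht.
  pose proof (Series_dominated a b H Ha) as Hs.
  assert (Hp : 0 <= sum_f_R0 a N)
    by (apply cond_pos_sum; intros k; eapply Rle_trans; [apply Rabs_pos | apply H]).
  revert Ht Hs Hp; generalize (Series b) (sum_f_R0 b N) (Series a) (sum_f_R0 a N).
  intros B b' A a' Ht Hs Hp.
  replace (B ^ 2 - b' ^ 2) with ((2 * B - (B - b')) * (B - b')) by ring.
  rewrite Rabs_mult.
  pose proof (Rabs_pos (B - b')).
  apply Rmult_le_compat; try apply Rabs_pos; auto.
  apply Rabs_le_between in Hs. apply Rabs_le_between in Ht.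
  apply Rabs_le. lra.
Qed.

(** * Mean square of an absolutely convergent trigonometric series *)

Section Parseval.

Variables (a w : nat -> R) (T : R).
Hypothesis Ha : ex_series (fun k => Rabs (a k)).
Hypothesis Hw : forall j k, (j < k)%nat ->
  is_RInt (fun t => cos ((w k - w j) * t)) 0 T 0.

(** The squared modulus of a partial sum of [a k * exp (- i * w k * t)], kept in real terms. *)
Let sq_part (N : nat) (t : R) : R :=
  sum_f_R0 (fun k => a k * cos (w k * t)) N ^ 2
  + sum_f_R0 (fun k => a k * sin (w k * t)) N ^ 2.

(** These cross terms appear when the term of index [k] joins a partial sum. The subtraction formula
    for the cosine merges each cosine and sine pair, so only frequency differences occur. *)
Lemma cross_is_RInt (k N : nat) : (N < k)%nat ->
  is_RInt (fun t =>
    cos (w k * t) * sum_f_R0 (fun j => a j * cos (w j * t)) N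
    + sin (w k * t) * sum_f_R0 (fun j => a j * sin (w j * t)) N) 0 T 0.
Proof.
  assert (Hj : forall j, (j < k)%nat ->
    is_RInt (fun t => a j * cos ((w k - w j) * t)) 0 T 0).
  { intros j Hj. replace 0 with (scal (a j) (0 : R)) at 2 by apply Rmult_0_r.
    apply (is_RInt_scal (V := R_NormedModule)). auto. }
  induction N as [|N IH]; intros HN.
  - eapply is_RInt_ext; [| exact (Hj 0%nat HN)].
    intros t _; simpl. rewrite Rmult_minus_distr_r, cos_minus. ring.
  - replace 0 with (plus 0 0) at 2 by apply Rplus_0_r.
    eapply is_RInt_ext;
      [| apply (is_RInt_plus (V := R_NormedModule));
         [apply IH; lia | exact (Hj (S N) HN)]].
    intros t _. unfold plus; simpl. rewrite Rmult_minus_distr_r, cos_minus. ring.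
Qed.

Lemma partial_is_RInt (N : nat) :
  is_RInt (sq_part N) 0 T (T * sum_f_R0 (fun k => a k ^ 2) N).
Proof.
  assert (Hc : forall c, is_RInt (fun _ => c) 0 T (T * c)).
  { intros c. replace (T * c) with (scal (T - 0) c)
      by (change ((T - 0) * c = T * c); ring).
    apply (is_RInt_const (V := R_NormedModule)). }
  unfold sq_part.
  induction N as [|N IH].
  - eapply is_RInt_ext; [| apply Hc]. intros t _; simpl.
    pose proof (sin2_cos2 (w 0%nat * t)) as E. unfold Rsqr in E.
    transitivity (a 0%nat ^ 2
      * (sin (w 0%nat * t) * sin (w 0%nat * t) + cos (w 0%nat * t) * cos (w 0%nat * t)));
      [rewrite E; ring | ring].
  (* Expanding the enlarged squares gives the old squares, [2 * a (S N)] times the cross terms, and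
     the diagonal term [a (S N) ^ 2]. *)
  - pose proof (is_RInt_scal (V := R_NormedModule) _ _ _ (2 * a (S N)) _
      (cross_is_RInt (S N) N (Nat.lt_succ_diag_r N))) as HX.
    pose proof (is_RInt_plus (V := R_NormedModule) _ _ _ _ _ _
      (is_RInt_plus (V := R_NormedModule) _ _ _ _ _ _ IH HX)
      (Hc (a (S N) ^ 2))) as HY.
    replace (T * sum_f_R0 (fun k => a k ^ 2) (S N)) with
      (plus (plus (T * sum_f_R0 (fun k => a k ^ 2) N) (scal (2 * a (S N)) 0))
         (T * a (S N) ^ 2))
      by (unfold plus, scal; simpl; unfold mult; simpl; ring).
    eapply is_RInt_ext; [| exact HY].
    intros t _. rewrite !tech5.
    pose proof (sin2_cos2 (w (S N) * t)) as E. unfold Rsqr in E.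
    unfold plus, scal; simpl; unfold mult; simpl.
    (* Multiplying the constant by [sin ^ 2 + cos ^ 2] turns the goal into a polynomial identity. *)
    replace (a (S N) * (a (S N) * 1)) with
      (a (S N) ^ 2
       * (sin (w (S N) * t) * sin (w (S N) * t) + cos (w (S N) * t) * cos (w (S N) * t)))
      by (rewrite E; ring).
    ring.
Qed.

Lemma is_RInt_sq_Series :
  is_RInt (fun t => Series (fun k => a k * cos (w k * t)) ^ 2
                    + Series (fun k => a k * sin (w k * t)) ^ 2) 0 T
    (T * Series (fun k => a k ^ 2)).
Proof.
  set (A := fun k => Rabs (a k)).
  assert (Hlim : forall b, ex_series b -> is_lim_seq (sum_f_R0 b) (Series b)).
  { intros b Hb. eapply is_lim_seq_ext; [| exact (Series_correct _ Hb)].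
    intros n; apply sum_n_Reals. }
  assert (Hcos : forall t k, Rabs (a k * cos (w k * t)) <= A k).
  { intros t k. unfold A. rewrite Rabs_mult.
    rewrite <- (Rmult_1_r (Rabs (a k))) at 2.
    apply Rmult_le_compat_l; [apply Rabs_pos |].
    apply Rabs_le, COS_bound. }
  assert (Hsin : forall t k, Rabs (a k * sin (w k * t)) <= A k).
  { intros t k. unfold A. rewrite Rabs_mult.
    rewrite <- (Rmult_1_r (Rabs (a k))) at 2.
    apply Rmult_le_compat_l; [apply Rabs_pos |].
    apply Rabs_le, SIN_bound. }
  (* Since [a k] tends to 0, eventually [a k ^ 2 <= Rabs (a k)]. *)
  assert (Hsq : ex_series (fun k => a k ^ 2)).
  { pose proof (ex_series_lim_0 A Ha) as H0.
    apply is_lim_seq_spec in H0. destruct (H0 (mkposreal 1 Rlt_0_1)) as [n0 Hn0].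
    apply (ex_series_incr_n _ n0).
    apply (ex_series_dominated (fun k => A (n0 + k)%nat)).
    - intros k. specialize (Hn0 (n0 + k)%nat ltac:(lia)). simpl in Hn0.
      unfold A in *. rewrite Rminus_0_r, Rabs_Rabsolu in Hn0.
      rewrite <- RPow_abs. pose proof (Rabs_pos (a (n0 + k)%nat)). nra.
    - now apply (ex_series_incr_n A n0). }
  destruct (filterlim_RInt sq_part 0 T eventually eventually_filter
    (fun t => Series (fun k => a k * cos (w k * t)) ^ 2
              + Series (fun k => a k * sin (w k * t)) ^ 2)
    (fun N => T * sum_f_R0 (fun k => a k ^ 2) N)) as [I [HI HR]].
  - exact partial_is_RInt.
  (* Convergence here is uniform: the rank [n0] has to serve every [t]. The constant 6 is twice the
     3 of the tail estimate, once for the cosines and once for the sines. *)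
  - apply filterlim_locally. intros eps.
    assert (H0 : is_lim_seq
      (fun N => 6 * Series A * (Series A - sum_f_R0 A N)) 0).
    { replace (Finite 0) with (Rbar_mult (6 * Series A) (Series A - Series A))
        by (simpl; f_equal; ring).
      apply is_lim_seq_scal_l, is_lim_seq_minus';
        [apply is_lim_seq_const | now apply Hlim]. }
    apply is_lim_seq_spec in H0. destruct (H0 eps) as [n0 Hn0].
    exists n0. intros n Hn t. specialize (Hn0 n Hn).
    rewrite Rminus_0_r in Hn0.
    apply Rle_lt_trans with (2 := Hn0).
    apply Rle_trans with (2 := Rle_abs _).
    pose proof (sq_Series_tail_dominated A _ n (Hcos t) Ha) as Ec.
    pose proof (sq_Series_tail_dominated A _ n (Hsin t) Ha) as Es.
    unfold abs, minus, plus, opp; simpl abs. unfold sq_part.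
    apply Rabs_le_between in Ec. apply Rabs_le_between in Es.
    apply Rabs_le. simpl in *. lra.
  (* The interchange theorem only provides some limit [I] of the partial integrals; uniqueness of
     limits identifies it. *)
  - replace (T * Series (fun k => a k ^ 2)) with I; [exact HR |].
    assert (Finite I = Finite (T * Series (fun k => a k ^ 2))) as E; [| now injection E].
    rewrite <- (is_lim_seq_unique _ (Finite I) HI).
    apply is_lim_seq_unique.
    apply (is_lim_seq_scal_l (sum_f_R0 (fun k => a k ^ 2)) T
             (Finite (Series (fun k => a k ^ 2)))). now apply Hlim.
Qed.

End Parseval.

(** * Cosine integrals, odd frequencies and Gaussian sums over [Z] *)

Lemma is_RInt_cos_scal (d T : R) : d <> 0 -> sin (d * T) = 0 ->
  is_RInt (fun t => cos (d * t)) 0 T 0.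
Proof.
  intros Hd H.
  replace 0 with (minus (sin (d * T) / d) (sin (d * 0) / d)) at 2.
  - apply (is_RInt_derive (fun t => sin (d * t) / d)).
    + intros t _. auto_derive; auto. field; auto.
    + intros t _. apply (ex_derive_continuous (V := R_NormedModule)).
      auto_derive; auto.
  - rewrite H, Rmult_0_r, sin_0. unfold minus, plus, opp; simpl. field; auto.
Qed.

(** Keeping the [IZR] form lets the terms of nonnegative index in the sums over [Z] match by
    conversion. *)
Definition oddR (j : nat) : R := IZR (2 * Z.of_nat j + 1).

Lemma oddR_neg (j : nat) : IZR (2 * (- Z.of_nat (S j)) + 1) = - oddR j.
Proof. unfold oddR. rewrite <- opp_IZR. f_equal. lia. Qed.

Lemma oddR_INR (j : nat) : oddR j = 2 * INR j + 1.
Proof. unfold oddR. now rewrite plus_IZR, mult_IZR, <- INR_IZR_INZ. Qed.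

(** At odd multiples of [PI / 2] the cosine vanishes and the sine is 1 or -1; squaring removes that
    sign. This turns the cosines of the theta coefficients into the sines of the final formula. *)
Lemma cos_shift_oddR_sq (j : nat) (y : R) :
  cos (y + PI / 2 * oddR j) ^ 2 = sin y ^ 2.
Proof.
  assert (C0 : cos (PI / 2 * oddR j) = 0).
  { apply cos_eq_0_1. exists (Z.of_nat j). rewrite oddR_INR, <- INR_IZR_INZ. field. }
  pose proof (sin2_cos2 (PI / 2 * oddR j)) as E. rewrite C0 in E.
  unfold Rsqr in E.
  rewrite cos_plus, C0.
  transitivity (sin y ^ 2 * (sin (PI / 2 * oddR j) * sin (PI / 2 * oddR j) + 0 * 0));
    [ring | rewrite E; ring].
Qed.

(** Comparison with the geometric series of ratio [exp (- c)], because [j <= (2 * j + 1) ^ 2]. *)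
Lemma ex_series_gauss_odd (c : R) (b : nat -> R) : 0 < c ->
  (forall j, Rabs (b j) <= exp (- c * oddR j ^ 2)) -> ex_series b.
Proof.
  intros Hc H. apply (ex_series_dominated (fun j => exp (- c) ^ j)).
  - intros j. eapply Rle_trans; [apply H |].
    rewrite <- (Rpower_pow j) by apply exp_pos.
    unfold Rpower. rewrite ln_exp.
    assert (Hj : INR j <= oddR j ^ 2)
      by (rewrite oddR_INR; pose proof (pos_INR j); nra).
    destruct (Rle_lt_or_eq_dec (- c * oddR j ^ 2) (INR j * - c)) as [L | E]; [nra | |].
    + left; now apply exp_increasing.
    + rewrite E; lra.
  - apply ex_series_geom.
    rewrite Rabs_pos_eq by (left; apply exp_pos).
    rewrite <- exp_0. apply exp_increasing. lra.
Qed.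

(** Folds a sum over [Z] along the pairing of [j] with [- j - 1]. As [Series] is total, adding
    termwise needs the convergence of both halves. *)
Lemma ZSeries_paired (f : Z -> R) (p q s : nat -> R) :
  (forall j, f (Z.of_nat j) = p j) ->
  (forall j, f (- Z.of_nat (S j))%Z = q j) ->
  (forall j, p j + q j = s j) ->
  ex_series p -> ex_series q -> ZSeries f = Series s.
Proof.
  intros Hp Hq Hs Ep Eq. unfold ZSeries.
  rewrite (Series_ext _ p Hp), (Series_ext _ q Hq), <- Series_plus by assumption.
  now apply Series_ext.
Qed.

Lemma Rabs_gauss_mult (u v : R) : Rabs v <= 1 -> Rabs (exp u * v) <= exp u.
Proof.
  intros H. rewrite Rabs_mult, (Rabs_pos_eq (exp u)) by (left; apply exp_pos).
  pose proof (exp_pos u). nra.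
Qed.

(** * The theta function as a one-sided series *)

Definition theta1_coef (z beta : R) (j : nat) : R :=
  2 * exp (- (PI * beta / 4) * oddR j ^ 2) * cos (PI * z * oddR j + PI / 2 * oddR j).

Lemma theta1_term_exponent (z s beta n : R) :
  (Ci * (PI * (RtoC (- s) + Ci * RtoC beta) / 4) * RtoC n ^ 2
   + Ci * (PI / 2) * (2 * RtoC z + 1) * RtoC n)%C
  = (- (PI * beta / 4) * n ^ 2,
     (PI * z * n + PI / 2 * n) - PI / 4 * n ^ 2 * s).
Proof.
  apply injective_projections; simpl; field.
Qed.

(** Under [n -> - n] the phase [y] is odd while the time phase [th] is even. Each pair therefore
    adds up to [2 * cos y] times the common factor [exp (- i * th)], with Gaussian weight. *)
Lemma theta1_real_series (z s beta : R) : 0 < beta ->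
  theta1 (RtoC z) (RtoC (- s) + Ci * RtoC beta)%C =
  (Series (fun j => theta1_coef z beta j * cos (PI / 4 * oddR j ^ 2 * s)),
   - Series (fun j => theta1_coef z beta j * sin (PI / 4 * oddR j ^ 2 * s))).
Proof.
  intros Hb. pose proof PI_RGT_0 as HPI.
  assert (Hc : 0 < PI * beta / 4) by nra.
  assert (Hbd : forall v : nat -> R, (forall j, -1 <= v j <= 1) ->
    ex_series (fun j => exp (- (PI * beta / 4) * oddR j ^ 2) * v j)).
  { intros v Hv. apply (ex_series_gauss_odd (PI * beta / 4)); auto.
    intros j. apply Rabs_gauss_mult, Rabs_le, Hv. }
  unfold theta1, CZSeries.
  (* The sign moves inside the series so that both components can be paired in the same way. *)
  rewrite <- Series_opp.
  set (y := fun j => PI * z * oddR j + PI / 2 * oddR j).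
  set (th := fun j => PI / 4 * oddR j ^ 2 * s).
  f_equal.
  - apply (ZSeries_paired _
      (fun j => exp (- (PI * beta / 4) * oddR j ^ 2) * cos (y j - th j))
      (fun j => exp (- (PI * beta / 4) * oddR j ^ 2) * cos (- y j - th j))).
    + intros j. rewrite theta1_term_exponent. reflexivity.
    + intros j. rewrite oddR_neg, theta1_term_exponent. unfold Cexp; simpl.
      f_equal; f_equal; unfold y, th; field.
    + intros j. unfold theta1_coef. fold (y j) (th j).
      rewrite !cos_minus, cos_neg, sin_neg. ring.
    + apply Hbd. intros; apply COS_bound.
    + apply Hbd. intros; apply COS_bound.
  - apply (ZSeries_paired _
      (fun j => exp (- (PI * beta / 4) * oddR j ^ 2) * sin (y j - th j))
      (fun j => exp (- (PI * beta / 4) * oddR j ^ 2) * sin (- y j - th j))).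
    + intros j. rewrite theta1_term_exponent. reflexivity.
    + intros j. rewrite oddR_neg, theta1_term_exponent. unfold Cexp; simpl.
      f_equal; f_equal; unfold y, th; field.
    + intros j. unfold theta1_coef. fold (y j) (th j).
      rewrite !sin_minus, cos_neg, sin_neg. ring.
    + apply Hbd. intros; apply SIN_bound.
    + apply Hbd. intros; apply SIN_bound.
Qed.

Lemma ex_series_theta1_coef (z beta : R) : 0 < beta ->
  ex_series (fun j => Rabs (theta1_coef z beta j)).
Proof.
  intros Hb. pose proof PI_RGT_0 as HPI.
  assert (Hc : 0 < PI * beta / 4) by nra.
  apply (ex_series_dominated (fun j => 2 * exp (- (PI * beta / 4) * oddR j ^ 2))).
  - intros j. unfold theta1_coef. rewrite Rabs_Rabsolu, Rmult_assoc, Rabs_mult.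
    rewrite (Rabs_pos_eq 2) by lra.
    apply Rmult_le_compat_l; [lra |].
    apply Rabs_gauss_mult, Rabs_le, COS_bound.
  - apply (ex_series_scal_l (V := R_NormedModule) 2).
    apply (ex_series_gauss_odd (PI * beta / 4)); auto.
    intros j. rewrite Rabs_pos_eq; [lra | left; apply exp_pos].
Qed.

(** The difference of two odd squares divided by 4 is the integer [(k - j) * (k + j + 1)], nonzero
    for [j < k]. Times [T], the frequency difference is thus an integer multiple of [PI], where the
    sine vanishes. *)
Lemma theta1_freq_orthogonal (T : R) (j k : nat) : 0 < T -> (j < k)%nat ->
  is_RInt (fun t =>
    cos ((PI / 4 * oddR k ^ 2 / T - PI / 4 * oddR j ^ 2 / T) * t)) 0 T 0.
Proof.
  intros HT Hjk. pose proof PI_RGT_0 as HPI.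
  assert (E : PI / 4 * oddR k ^ 2 / T - PI / 4 * oddR j ^ 2 / T
    = (INR k - INR j) * (INR k + INR j + 1) * (PI / T))
    by (rewrite !oddR_INR; field; lra).
  rewrite E. apply is_RInt_cos_scal.
  - apply lt_INR in Hjk. pose proof (pos_INR j).
    apply Rgt_not_eq, Rmult_lt_0_compat;
      [apply Rmult_lt_0_compat; lra | now apply Rdiv_lt_0_compat].
  - apply sin_eq_0_1.
    exists ((Z.of_nat k - Z.of_nat j) * (Z.of_nat k + Z.of_nat j + 1))%Z.
    rewrite mult_IZR, minus_IZR, !plus_IZR, <- !INR_IZR_INZ. field; lra.
Qed.

(** * Normalisation and the time average *)

Lemma Nbeta_pos (l beta : R) : 0 < l -> 0 < beta -> 0 < Nbeta l beta.
Proof.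
  intros Hl Hb. pose proof PI_RGT_0 as HPI.
  set (g := fun j => exp (- (PI * beta / 2) * oddR j ^ 2)).
  assert (Hg : ex_series g).
  { apply (ex_series_gauss_odd (PI * beta / 2)); [nra |].
    intros j. rewrite Rabs_pos_eq; [unfold g; lra | left; apply exp_pos]. }
  unfold Nbeta.
  rewrite (ZSeries_paired _ g g (fun j => 2 * g j)); auto.
  - apply Rmult_lt_0_compat; auto.
    rewrite Series_scal_l. apply Rmult_lt_0_compat; [lra |].
    rewrite Series_incr_1 by assumption.
    assert (0 <= Series (fun k => g (S k))).
    (* Writing the zero terms as [0 * 0] lets [Series_scal_l] evaluate the zero series. *)
    { apply Rle_trans with (Series (fun _ : nat => 0 * 0)).
      - rewrite Series_scal_l; lra.
      - apply Series_le.
        + intros n; split; [lra |]. rewrite Rmult_0_l. left; apply exp_pos.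
        + now apply (ex_series_incr_1 g). }
    pose proof (exp_pos (- (PI * beta / 2) * oddR 0 ^ 2)). unfold g at 1. lra.
  - intros j. rewrite oddR_neg. unfold g. f_equal; ring.
  - intros j; ring.
Qed.

Lemma Cmod_sq (z : C) : Cmod z ^ 2 = Re z ^ 2 + Im z ^ 2.
Proof. apply pow2_sqrt. nra. Qed.

(* Stdlib reals with Coquelicot *)
Theorem theorem4 :
  forall (m l hbar : R) (mu : nat) (beta : R),
    0 < m -> 0 < l -> 0 < hbar -> (1 <= mu)%nat -> 0 < beta ->
    forall x : R, 0 <= x <= l ->
      f1_mean m l hbar mu beta x =
      2 / Nbeta l beta *
      ZSeries (fun k : Z =>
        exp (- (PI * beta / 2) * IZR (2 * k + 1) ^ 2)
        * sin (IZR (2 * k + 1) * (PI * INR mu / l) * x) ^ 2).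
Proof.
  intros m l hbar mu beta Hm Hl Hh Hmu Hb x _.
  pose proof PI_RGT_0 as HPI.
  pose proof (Nbeta_pos l beta Hl Hb) as HN.
  assert (Hmu' : 0 < INR mu) by (apply lt_0_INR; lia).
  assert (HT : 0 < Tmu m l hbar mu).
  { unfold Tmu. apply Rdiv_lt_0_compat;
      repeat (assumption || apply pow_lt || apply Rlt_0_2 || apply Rmult_lt_0_compat). }
  set (z := INR mu * (x / l)). set (T := Tmu m l hbar mu) in *.
  set (a := theta1_coef z beta). set (w := fun j => PI / 4 * oddR j ^ 2 / T).
  assert (Hf : forall t, f1 m l hbar mu beta x t = / Nbeta l beta *
    (Series (fun k => a k * cos (w k * t)) ^ 2
     + Series (fun k => a k * sin (w k * t)) ^ 2)).
  { intros t. unfold f1, Psi.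
    (* The averaging time is exactly the inverse of the time factor in the modulus, whose real part
       becomes [- (t / T)]. *)
    replace (INR mu ^ 2 * (2 * PI * hbar / (m * l ^ 2)) * t) with (t / T)
      by (unfold T, Tmu; field; repeat split; lra).
    rewrite theta1_real_series by assumption.
    rewrite Cmod_mult, Rpow_mult_distr, Cmod_R, pow2_abs, Cmod_sq. simpl Re; simpl Im.
    f_equal.
    - rewrite <- (pow2_sqrt (Nbeta l beta)) at 2 by lra.
      field. apply Rgt_not_eq, sqrt_lt_R0, HN.
    (* The minus sign of the imaginary part disappears in the square. *)
    - rewrite <- (Rsqr_pow2 (- _)), <- Rsqr_neg, Rsqr_pow2.
      f_equal; f_equal; apply Series_ext; intros k; unfold w;
        f_equal; f_equal; field; lra. }
  unfold f1_mean. fold T.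
  rewrite (is_RInt_unique _ _ _ (/ Nbeta l beta * (T * Series (fun k => a k ^ 2)))).
  2: { eapply is_RInt_ext; [intros t _; symmetry; apply Hf |].
    apply (is_RInt_scal (V := R_NormedModule)), is_RInt_sq_Series.
    - now apply ex_series_theta1_coef.
    - intros j k Hjk. now apply theta1_freq_orthogonal. }
  (* The target summand is even in the odd integer, so both halves of its sum equal [Series g]. *)
  set (g := fun j => exp (- (PI * beta / 2) * oddR j ^ 2) * sin (PI * z * oddR j) ^ 2).
  assert (Hg : ex_series g).
  { apply (ex_series_gauss_odd (PI * beta / 2)); [nra |].
    intros j. apply Rabs_gauss_mult, Rabs_le.
    pose proof (SIN_bound (PI * z * oddR j)). nra. }
  rewrite (ZSeries_paired _ g g (fun j => 2 * g j)); auto.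
  - rewrite Series_scal_l.
    (* Squaring a coefficient gives the factor 4 and doubles the Gaussian exponent from [beta / 4]
       to [beta / 2]; half of the 4 is absorbed by folding the target sum, leaving the 2 of the
       formula. *)
    replace (Series (fun k => a k ^ 2)) with (4 * Series g).
    { field. lra. }
    rewrite <- Series_scal_l. apply Series_ext. intros j.
    unfold a, theta1_coef, g.
    rewrite <- cos_shift_oddR_sq with (j := j).
    replace (- (PI * beta / 2) * oddR j ^ 2) with
      (- (PI * beta / 4) * oddR j ^ 2 + - (PI * beta / 4) * oddR j ^ 2) by field.
    rewrite exp_plus. ring.
  - intros j. fold (oddR j). unfold g, z. simpl pow.
    replace (oddR j * (PI * INR mu / l) * x) with (PI * (INR mu * (x / l)) * oddR j)
      by (field; lra). reflexivity.
  - intros j. rewrite oddR_neg. unfold g, z.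
    replace (- oddR j * (PI * INR mu / l) * x)
      with (- (PI * (INR mu * (x / l)) * oddR j)) by (field; lra).
    rewrite sin_neg. f_equal; [f_equal; ring | ring].
  - intros j; ring.
Qed.
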